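(* Let $p$ be the mesh pattern $(12,R)$ with $R=\{(0,0),(0,1),(0,2),(2,0),(2,1),(2,2)\}$, and let $A_n=|K_n|$. For every $n\ge2$, exactly $A_n/2$ king permutations of length $n$ avoid $p$, and exactly $A_n/2$ king permutations of length $n$ contain exactly one occurrence of $p$.
   Context: A permutation $\sigma=\sigma_1\cdots\sigma_n$ of $\{1,\dots,n\}$ is a king permutation if $|\sigma_{i+1}-\sigma_i|>1$ for all $1\le i\le n-1$; $K_n$ is the set of king permutations of length $n$. For a mesh pattern $p=(12,R)$ with $R\subseteq\{0,1,2\}^2$, an occurrence of $p$ in $\sigma\in S_n$ is a pair of positions $i_1<i_2$ with $\sigma_{i_1}<\sigma_{i_2}$ such that for every $(x,y)\in R$ there is no position $m$ with $i_x<m<i_{x+1}$ and $v_y<\sigma_m<v_{y+1}$, where $i_0=0$, $i_3=n+1$, $v_0=0$, $v_1=\sigma_{i_1}$, $v_2=\sigma_{i_2}$, $v_3=n+1$ (first coordinate of a box indexes positions, second values). $\sigma$ avoids $p$ if it has no occurrence of $p$. *)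

(* Defs.v *)
From mathcomp Require Export all_boot all_order all_algebra all_fingroup.

Set Implicit Arguments.
Unset Strict Implicit.
Unset Printing Implicit Defensive.

(* A permutation of {1, ..., n} is s : 'S_n; the 0-based position i : 'I_n
   stands for i.+1, and the 0-based value s i stands for (s i).+1. *)

Definition king n (s : 'S_n) : bool :=
  [forall i : 'I_n, forall j : 'I_n,
     (j == i.+1 :> nat) ==> (1 < `|(s j)%:Z - (s i)%:Z|)%R].

Definition king_perms n : {set 'S_n} := [set s | king s].

(* (1-based) grid lines i_0, ..., i_3 and v_0, ..., v_3 cut out by an
   occurrence of 12 at the positions i1, i2. *)
Definition pos_line n (i1 i2 : 'I_n) (x : nat) : nat :=
  nth 0 [:: 0; i1.+1; i2.+1; n.+1] x.

Definition val_line n (s : 'S_n) (i1 i2 : 'I_n) (y : nat) : nat :=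
  nth 0 [:: 0; (s i1).+1; (s i2).+1; n.+1] y.

(* The first coordinate of a box indexes positions, the second one values. *)
Definition box_empty n (s : 'S_n) (i1 i2 : 'I_n) (b : 'I_3 * 'I_3) : bool :=
  ~~ [exists m : 'I_n,
        (pos_line i1 i2 b.1 < m.+1 < pos_line i1 i2 b.1.+1) &&
        (val_line s i1 i2 b.2 < (s m).+1 < val_line s i1 i2 b.2.+1)].

Definition mesh12_occurrence (R : {set 'I_3 * 'I_3}) n (s : 'S_n)
    (i1 i2 : 'I_n) : bool :=
  [&& i1 < i2, s i1 < s i2 & [forall b in R, box_empty s i1 i2 b]].

Definition mesh12_occurrences (R : {set 'I_3 * 'I_3}) n (s : 'S_n) :
    {set 'I_n * 'I_n} :=
  [set i | mesh12_occurrence R s i.1 i.2].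

Definition mesh12_avoids (R : {set 'I_3 * 'I_3}) n (s : 'S_n) : bool :=
  mesh12_occurrences R s == set0.

Definition box (x y : nat) : 'I_3 * 'I_3 := (inord x, inord y).

Definition R_p : {set 'I_3 * 'I_3} :=
  [set box 0 0; box 0 1; box 0 2; box 2 0; box 2 1; box 2 2].

(* Main.v *)
Require Import Defs.
From mathcomp Require Import zify ring.

Set Implicit Arguments.
Unset Strict Implicit.
Unset Printing Implicit Defensive.

(** The shaded boxes are the whole outer columns, so an occurrence of the
    pattern must use the first and the last positions; it exists, and is then
    unique, exactly when the first value is smaller than the last one.
    Complementing the values preserves king permutations and swaps the two
    cases, so each case accounts for half of the king permutations. *)

(** By injectivity the value at [m] differs from [s i1] and [s i2], so it lies strictly inside one
    of the three horizontal strips; [m] in column [x] would therefore occupy one of its boxes. *)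
Lemma column_empty n (s : 'S_n) (i1 i2 : 'I_n) (x : nat) (m : 'I_n) :
    s i1 < s i2 -> x < 3 -> m != i1 -> m != i2 ->
    (forall y, y < 3 -> box_empty s i1 i2 (box x y)) ->
  ~~ (pos_line i1 i2 x < m.+1 < pos_line i1 i2 x.+1).
Proof.
move=> lt12 lt_x3 ne1 ne2 emp; apply/negP=> Hx.
have{ne1}: (s m : nat) <> s i1 by move/val_inj/perm_inj/eqP; rewrite (negPf ne1).
have{ne2}: (s m : nat) <> s i2 by move/val_inj/perm_inj/eqP; rewrite (negPf ne2).
have := ltn_ord (s m) => ltn ne2 ne1.
have [y lt_y3 Hy] : exists2 y, y < 3 &
    val_line s i1 i2 y < (s m).+1 < val_line s i1 i2 y.+1.
  case: (ltnP (s m) (s i1)) => h1; first by exists 0 => //; rewrite /val_line /=; lia.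
  case: (ltnP (s m) (s i2)) => h2; first by exists 1 => //; rewrite /val_line /=; lia.
  by exists 2 => //; rewrite /val_line /=; lia.
move: (emp y lt_y3); rewrite /box_empty => /existsPn /(_ m).
by rewrite /box /= !inordK // Hx Hy.
Qed.

Lemma mesh12_occurrence_R_pE n (s : 'S_n.+2) (i1 i2 : 'I_n.+2) :
  mesh12_occurrence R_p s i1 i2 =
    [&& i1 == ord0, i2 == ord_max & s ord0 < s ord_max].
Proof.
apply/and3P/and3P => [[lt_i lt_s /forall_inP emp]|[/eqP-> /eqP-> lt_s]].
  have col x : (x == 0) || (x == 2) ->
      forall y, y < 3 -> box_empty s i1 i2 (box x y).
    case/orP=> /eqP-> [|[|[|y]]] // _; apply: emp;
      by rewrite !inE eqxx ?orbT.
  have i1E : i1 = ord0.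
    (* Otherwise [ord0] lies left of both [i1] and [i2], inside the left column; symmetrically,
       [ord_max] is the offending position for [i2]. *)
    apply/eqP; apply/negPn/negP => ne; have pos : 0 < i1 by rewrite lt0n.
    have := @column_empty _ s i1 i2 0 ord0 lt_s isT.
    rewrite -!val_eqE /pos_line /= => /(_ _ _ (col 0 isT)); lia.
  have i2E : i2 = ord_max.
    apply/eqP; apply/negPn/negP => ne.
    have pos : i2 < n.+1 by rewrite ltn_neqAle ne -ltnS ltn_ord.
    have := @column_empty _ s i1 i2 2 ord_max lt_s isT.
    rewrite -!val_eqE /pos_line /= => /(_ _ _ (col 2 isT)); lia.
  by rewrite -i1E -i2E !eqxx.
split=> //; apply/forall_inP => b.
rewrite !inE -!orbA => Hb; apply/existsPn => m; have := ltn_ord m.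
by move: Hb; do 5?[case/orP]; move/eqP->; rewrite /box /pos_line /= inordK //=; lia.
Qed.

Lemma mesh12_occurrences_R_pE n (s : 'S_n.+2) :
  mesh12_occurrences R_p s =
    if s ord0 < s ord_max then [set (ord0, ord_max)] else set0.
Proof.
apply/setP=> -[i j]; rewrite inE mesh12_occurrence_R_pE /=.
by case: ifP => _; rewrite !inE ?xpair_eqE ?andbT ?andbF.
Qed.

(** The left factor of the product acts first, so [rev_ord] reverses the values and not the
    positions. *)
Definition perm_complement n (s : 'S_n) : 'S_n := (s * perm (@rev_ord_inj n))%g.

Lemma perm_complementE n (s : 'S_n) (i : 'I_n) : perm_complement s i = rev_ord (s i).
Proof. by rewrite permM permE. Qed.

Lemma perm_complementK n : involutive (@perm_complement n).
Proof. by move=> s; apply/permP=> i; rewrite !perm_complementE rev_ordK. Qed.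

Lemma king_complement n (s : 'S_n) : king (perm_complement s) = king s.
Proof.
apply: eq_forallb => i; apply: eq_forallb => j; congr (_ ==> _).
rewrite !perm_complementE /=; have := ltn_ord (s i); have := ltn_ord (s j); lia.
Qed.

Lemma perm_complement_lt n (s : 'S_n) (i j : 'I_n) :
  (perm_complement s i < perm_complement s j) = (s j < s i).
Proof.
rewrite !perm_complementE /=; have := ltn_ord (s i); have := ltn_ord (s j); lia.
Qed.

Lemma card_king_ascending_ends n :
  #|[set s in king_perms n.+2 | s ord0 < s ord_max]| =
  #|[set s in king_perms n.+2 | ~~ (s ord0 < s ord_max)]|.
Proof.
rewrite -(card_imset _ (inv_inj (@perm_complementK n.+2))); apply: eq_card => s.
rewrite -{1}[s]perm_complementK mem_imset; last exact: inv_inj (@perm_complementK _).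
(* Negating [<] gives only [<=]; it is strict because [ord0] and [ord_max] are distinct in ['I_n.+2]
   and [s] is injective. *)
rewrite !inE king_complement perm_complement_lt -leqNgt ltn_neqAle; congr (_ && _).
by rewrite (inj_eq val_inj) (inj_eq perm_inj).
Qed.

Theorem theorem3p2 (n : nat) (hn : 2 <= n) :
  (#|[set s in king_perms n | mesh12_avoids R_p s]|%:R
     = #|king_perms n|%:R / 2 :> rat)%R /\
  (#|[set s in king_perms n | #|mesh12_occurrences R_p s| == 1%N]|%:R
     = #|king_perms n|%:R / 2 :> rat)%R.
Proof.
case: n hn => [|[|n]] // _.
set U := [set s in _ | mesh12_avoids _ _]; set D := [set s in _ | _ == _].
have UE : U = [set s in king_perms n.+2 | ~~ (s ord0 < s ord_max)].
  apply/setP=> s; rewrite !inE /mesh12_avoids mesh12_occurrences_R_pE.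
  by case: ifP => _; rewrite ?eqxx // -cards_eq0 cards1.
have DE : D = [set s in king_perms n.+2 | s ord0 < s ord_max].
  apply/setP=> s; rewrite !inE mesh12_occurrences_R_pE.
  by case: ifP => _; rewrite ?cards1 ?cards0.
have eqUD : #|U| = #|D| by rewrite UE DE card_king_ascending_ends.
(* The comparison of the end values splits the king permutations into [D] and [U], so each is half
   of the total. *)
have : #|king_perms n.+2| = #|D| + #|U|.
  rewrite -(cardsID [set s : 'S_n.+2 | s ord0 < s ord_max]) UE DE.
  by congr (_ + _); apply: eq_card => s; rewrite !inE // andbC.
rewrite eqUD => ->; rewrite GRing.natrD; split; by field.
Qed.
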